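(* Consider three currencies $0,1,2$ with $E[Q_{01}]=E[Q_{02}]=q$, $E[Q_{12}]=vq$, $\sigma_{01}^2=\sigma_{02}^2=\sigma^2$, $\sigma_{12}^2=s^2\sigma^2$, where $v>0$ and $s\in[0,2]$. For weights $w_0,w_1,w_2>0$ with $w_0+w_1+w_2=1$ let the expected aggregate trading cost be $$c(w)=\sqrt{\Delta\,H_w\sum_{i=0}^2\frac{E[Q_i]}{w_i}},\qquad H_w=\sum_{0\le i<j\le 2}w_iw_j\sigma_{ij}^2,\qquad E[Q_i]=\sum_{j\neq i}E[Q_{ij}].$$ If $s^2<\dfrac{2(1+2v)}{1+v}$, then the expected aggregate trading cost has a unique interior minimizer, at $w_1^*=w_2^*=\dfrac{1-w_0^*}{2}$ and $$w_0^*=\frac{s}{\sqrt{(1+2v)(4-s^2)}},\qquad\text{with}\qquad c^*=\sqrt{q\sigma^2\Delta}\,\sqrt{s^2v+2+s\sqrt{(4-s^2)(1+2v)}}.$$ If $s^2\ge\dfrac{2(1+2v)}{1+v}$, no interior minimizer exists; the infimum over $w_1,w_2>0$ is obtained as $w_0\to1$.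
   Context: Currency $0$ is a vehicle currency (numeraire); $q,\sigma,\Delta>0$. $\sigma_{ij}^2$ is the variance of the difference of the gross returns of currencies $i$ and $j$, and $E[Q_{ij}]=E[Q_{ji}]$ is the expected trading volume of the pair $(i,j)$. The range $s\in[0,2]$ is forced by the Cauchy–Schwarz inequality. The cost $c(w)$ is the fee-optimized equilibrium expected aggregate trading cost of a constant-mean AMM pool (invariant $\prod_i R_i^{w_i}=$ const in the reserves $R_i$) with weights $w$ and trade size $\Delta$; $c^*$ is its value at the minimizer. Since currencies $1$ and $2$ are symmetric, the cost-minimizing weights are taken to satisfy $w_1=w_2=(1-w_0)/2$, so that the problem is an optimization over the scalar $w_0\in(0,1)$.
   Formalization: The unique-minimizer claim is proved for s>0: at s=0 the formula gives w_0*=0, which is not interior, and no interior minimizer exists. For s=0 it is proved instead that there is none and that the infimum is c*, approached as w_0→0. *)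

(* Defs.v *)
From HB Require Import structures.
From mathcomp Require Import all_boot all_order all_algebra.
From mathcomp Require Import all_classical all_reals all_analysis.
Set Implicit Arguments.
Unset Strict Implicit.
Unset Printing Implicit Defensive.
Import Order.TTheory GRing.Theory Num.Theory.
Import numFieldNormedType.Exports.
Local Open Scope classical_set_scope.
Local Open Scope ring_scope.

Section Pool.
Variables (R : realType) (n : nat).

(* [EQ i j] is E[Q_ij], the expected trading volume of the pair (i, j). *)
Definition expected_volume (EQ : 'I_n -> 'I_n -> R) (i : 'I_n) : R :=
  \sum_(j < n | j != i) EQ i j.

(* [var i j] is sigma_ij^2, the variance of the difference of the gross
   returns of currencies i and j; only the entries with i < j matter. *)
Definition weighted_variance (var : 'I_n -> 'I_n -> R)
    (w : {ffun 'I_n -> R}) : R :=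
  \sum_(i < n) \sum_(j < n | (i < j)%N) w i * w j * var i j.

Definition trading_cost (Delta : R) (EQ var : 'I_n -> 'I_n -> R)
    (w : {ffun 'I_n -> R}) : R :=
  Num.sqrt (Delta * weighted_variance var w *
            \sum_(i < n) expected_volume EQ i / w i).

Definition interior_weights : set {ffun 'I_n -> R} :=
  [set w | (forall i, 0 < w i) /\ \sum_(i < n) w i = 1].

End Pool.
Arguments interior_weights : clear implicits.

Definition currency0 : 'I_3 := @Ordinal 3 0 isT.
Definition currency1 : 'I_3 := @Ordinal 3 1 isT.
Definition currency2 : 'I_3 := @Ordinal 3 2 isT.

Definition symmetric_weights (R : realType) (w0 : R) : {ffun 'I_3 -> R} :=
  [ffun i => if i == currency0 then w0 else (1 - w0) / 2].

(* The set of all minimizers of [f] over [A]: "x is the unique minimizer" is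
   [argmin A f = [set x]], "there is no minimizer" is [argmin A f = set0]. *)
Definition argmin (R : realType) (T : Type) (A : set T) (f : T -> R) : set T :=
  [set x | A x /\ forall y, A y -> f x <= f y].

(* Main.v *)
Require Import Defs.
From HB Require Import structures.
From mathcomp Require Import all_boot all_order all_algebra.
From mathcomp Require Import all_classical all_reals all_analysis.
From mathcomp Require Import ring lra.
Set Implicit Arguments.
Unset Strict Implicit.
Unset Printing Implicit Defensive.
Import Order.TTheory GRing.Theory Num.Theory.
Import numFieldNormedType.Exports.
Local Open Scope classical_set_scope.
Local Open Scope ring_scope.

(* Up to the factor q sigma^2 Delta, the squared cost at the weights
   (a, (1 - a)/2, (1 - a)/2) is
     2 + s^2 v + s^2 / (2 a) + a (1 + 2 v) (4 - s^2) / 2,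
   and completing the square gives its minimum over a > 0.  The point
   minimizing it lies below 1 exactly under the threshold; above the threshold
   the cost is strictly decreasing on (0, 1].  Every asymmetric weight vector is
   strictly beaten by some symmetric one, possibly with a different a, so the
   problem over all weights has the same minimizers and infimum. *)

(** * The squared cost without its constant factor *)

Definition normalized_cost (R : realType) (v t a b c : R) : R :=
  (a * (b + c) + t * (b * c)) * (2 / a + (1 + v) * (b^-1 + c^-1)).

Definition symmetric_cost (R : realType) (v t a : R) : R :=
  2 + t * v + t / (2 * a) + a * ((1 + 2 * v) * (4 - t)) / 2.

(** Kept general in [P] so that one rewrite also expands the inner sums over j != i and over i <
    j. *)
Lemma sum_ord3 (R : realType) (P : pred 'I_3) (F : 'I_3 -> R) :
  \sum_(i < 3 | P i) F i =
  (if P currency0 then F currency0 else 0) +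
  (if P currency1 then F currency1 else 0) +
  (if P currency2 then F currency2 else 0).
Proof.
rewrite big_mkcond !big_ord_recl big_ord0 /= addr0 addrA.
have -> : ord0 = currency0 :> 'I_3 by apply: val_inj.
have -> : lift currency0 (@ord0 1) = currency1 :> 'I_3 by apply: val_inj.
by have -> : lift currency0 (lift ord0 ord0) = currency2 :> 'I_3 by apply: val_inj.
Qed.

Lemma trading_costE (R : realType) (q sigma Delta v s : R)
    (EQ var : 'I_3 -> 'I_3 -> R) (w : {ffun 'I_3 -> R}) :
  (forall i j, EQ i j = EQ j i) ->
  EQ currency0 currency1 = q -> EQ currency0 currency2 = q ->
  EQ currency1 currency2 = v * q ->
  var currency0 currency1 = sigma ^+ 2 ->
  var currency0 currency2 = sigma ^+ 2 ->
  var currency1 currency2 = s ^+ 2 * sigma ^+ 2 ->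
  trading_cost Delta EQ var w =
  Num.sqrt (q * sigma ^+ 2 * Delta *
    normalized_cost v (s ^+ 2) (w currency0) (w currency1) (w currency2)).
Proof.
move=> EQ_sym e01 e02 e12 v01 v02 v12.
rewrite /trading_cost /weighted_variance /expected_volume !sum_ord3 /=.
rewrite (EQ_sym currency1 currency0) (EQ_sym currency2 currency0).
rewrite (EQ_sym currency2 currency1) e01 e02 e12 v01 v02 v12.
by congr Num.sqrt; rewrite /normalized_cost; ring.
Qed.

(** * Asymmetric weights against symmetric ones *)

Lemma normalized_cost_symmetric (R : realType) (v t a : R) :
  0 < a < 1 ->
  normalized_cost v t a ((1 - a) / 2) ((1 - a) / 2) = symmetric_cost v t a.
Proof.
move=> /andP[a0 a1]; rewrite /normalized_cost /symmetric_cost.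
by field; rewrite subr_eq0 !gt_eqF.
Qed.

(* Moving mass between currencies 1 and 2 at fixed [a] only pays off when
   2 (1 + v) a^2 <= s^2 b c.  In that regime AM-GM bounds the cost below by
   (1 - a) (2 + s^2 (1 + v) + 2 s sqrt (2 (1 + v))), which is decreasing in [a];
   at the end [x] of the regime this bound is the symmetric cost. *)
Lemma normalized_cost_ge_symmetric (R : realType) (v s a b c : R) :
  0 < v -> 0 <= s -> 0 < a -> 0 < b -> 0 < c -> a + b + c = 1 -> b != c ->
  exists2 x, 0 < x < 1 &
    symmetric_cost v (s ^+ 2) x < normalized_cost v (s ^+ 2) a b c.
Proof.
move=> v0 s0 a0 b0 c0 abc bc.
have bc2 : 0 < (b - c) ^+ 2 by rewrite exprn_even_gt0 //= subr_eq0.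
have [lt|ge] := ltP (s ^+ 2 * (b * c)) (2 * (1 + v) * a ^+ 2).
  exists a; first by rewrite a0 /=; lra.
  (* At fixed b + c the excess over the symmetric cost has the sign of 2 (1 + v) a^2 - s^2 b c. *)
  have -> : normalized_cost v (s ^+ 2) a b c = symmetric_cost v (s ^+ 2) a +
      (b - c) ^+ 2 / 2 * (2 * (1 + v) * a ^+ 2 - s ^+ 2 * (b * c)) / (a * (b * c)).
    rewrite /normalized_cost /symmetric_cost.
    have -> : a = 1 - b - c by lra.
    field; rewrite !gt_eqF //=; lra.
  rewrite ltrDl; apply: divr_gt0; last by rewrite !mulr_gt0.
  by apply: mulr_gt0; [apply: divr_gt0 | rewrite subr_gt0].
have sgt0 : 0 < s.
  rewrite lt0r s0 andbT; apply: contraTneq ge => ->.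
  by rewrite expr0n /= mul0r -ltNge !mulr_gt0 ?exprn_gt0 //; lra.
(* Then s n = 2 s sqrt (2 (1 + v)), and the AM-GM bound becomes (1 - a) times 2 (1 + s n / 4)^2. *)
set n := Num.sqrt (8 * (1 + v)).
have n0 : 0 < n by rewrite sqrtr_gt0; lra.
have n2 : n ^+ 2 = 8 * (1 + v) by rewrite sqr_sqrtr //; lra.
have vE : v = n ^+ 2 / 8 - 1 by lra.
(* As b != c, 4 b c < (1 - a)^2, so the regime puts [a] strictly below s / (n + s). *)
have alt : a * n < s * (1 - a).
  rewrite -ltr_sqr ?nnegrE ?mulr_ge0 ?ltW //; last lra.
  rewrite !exprMn n2.
  have : 4 * (s ^+ 2 * (b * c)) < s ^+ 2 * (1 - a) ^+ 2.
    have -> : s ^+ 2 * (1 - a) ^+ 2 =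
        4 * (s ^+ 2 * (b * c)) + s ^+ 2 * (b - c) ^+ 2.
      have -> : a = 1 - b - c by lra.
      by ring.
    by rewrite ltrDl mulr_gt0 // exprn_gt0.
  lra.
(* This x solves x n = s (1 - x), the equality case of the regime when b = c. *)
exists (s / (n + s)).
  by rewrite divr_gt0 ?addr_gt0 //= ltr_pdivrMr ?addr_gt0 // mul1r; lra.
apply: (@lt_le_trans _ _ ((1 - a) * (2 * (1 + s * n / 4) ^+ 2))).
  have -> : symmetric_cost v (s ^+ 2) (s / (n + s)) =
      n / (n + s) * (2 * (1 + s * n / 4) ^+ 2).
    rewrite /symmetric_cost vE; field; rewrite !gt_eqF //; lra.
  rewrite ltr_pM2r; last first.
    by rewrite mulr_gt0 // exprn_gt0 // addr_gt0 // divr_gt0 // mulr_gt0.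
  rewrite ltr_pdivrMr; lra.
rewrite -subr_ge0.
(* AM-GM between (1 + v) a (1 - a)^2 / (b c) and 2 s^2 b c / a, its gap written as a square. *)
have -> : normalized_cost v (s ^+ 2) a b c - (1 - a) * (2 * (1 + s * n / 4) ^+ 2) =
    2 / (a * (b * c)) * (s * (b * c) - n * a * (1 - a) / 4) ^+ 2.
  rewrite /normalized_cost vE.
  have -> : a = 1 - b - c by lra.
  field; rewrite !gt_eqF //=; lra.
by rewrite mulr_ge0 ?sqr_ge0 // divr_ge0 // !mulr_ge0 ?ltW.
Qed.

(** * The symmetric cost: completed square and monotonicity *)

Lemma symmetric_cost_completed_square (R : realType) (v s r a : R) :
  0 < a -> r ^+ 2 = (4 - s ^+ 2) * (1 + 2 * v) ->
  symmetric_cost v (s ^+ 2) a = s ^+ 2 * v + 2 + s * r + (s - a * r) ^+ 2 / (2 * a).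
Proof.
move=> a0 r2; rewrite /symmetric_cost (mulrC (1 + 2 * v)) -r2.
by field; rewrite gt_eqF.
Qed.

(** The threshold amounts to (1 + 2 v) (4 - t) <= t, and x y < 1 for distinct x, y in (0, 1]. The
    endpoint 1 is included so that the limit there can be compared with interior values. *)
Lemma symmetric_cost_decreasing (R : realType) (v t : R) :
  0 < v -> t <= 4 -> 2 * (1 + 2 * v) / (1 + v) <= t ->
  {in `]0, 1] &, {homo symmetric_cost v t : x y /~ x < y}}.
Proof.
move=> v0 t4 le x y; rewrite !in_itv /= => /andP[x0 x1] /andP[y0 y1] yx.
have {}le : (1 + 2 * v) * (4 - t) <= t.
  by move: le; rewrite ler_pdivrMr; lra.
rewrite -subr_gt0.
have -> : symmetric_cost v t y - symmetric_cost v t x =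
  (x - y) / (2 * (x * y)) * (t - (x * y) * ((1 + 2 * v) * (4 - t))).
  by rewrite /symmetric_cost; field; rewrite !gt_eqF.
have xy : 0 < x * y by rewrite mulr_gt0.
have t0 : 0 < t by nra.
rewrite mulr_gt0 ?divr_gt0 ?subr_gt0 //; first by rewrite mulr_gt0.
have : x * y < 1 by nra.
nra.
Qed.

(** * Infima and minimizers under domination, and regularity of the cost *)

Lemma cvg_inf (R : realType) (T : Type) (F : set_system T) {FF : ProperFilter F}
    (A : set R) (g : T -> R) (l : R) :
  lbound A l -> (\forall x \near F, A (g x)) -> g x @[x --> F] --> l ->
  inf A = l.
Proof.
move=> Al Ag gl.
have A0 : A !=set0 by have [x ?] := filter_ex Ag; exists (g x).
apply/eqP; rewrite eq_le lb_le_inf // andbT.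
rewrite -(cvg_lim _ gl) //; apply: limr_ge; first by apply/cvg_ex; exists l.
by near=> x; apply: ge_inf; [exists l | near: x].
Unshelve. all: by end_near. Qed.

(** Domination is strict outside the image of [h], so no minimizer can lie there. *)
Lemma argmin_image (R : realType) (T U : Type) (A : set T) (B : set U)
    (h : U -> T) (f : T -> R) :
  (forall u, B u -> A (h u)) ->
  (forall w, A w -> (h @` B) w \/ exists2 u, B u & f (h u) < f w) ->
  argmin A f = h @` argmin B (f \o h).
Proof.
move=> hBA dom; apply/seteqP; split=> [w [Aw wmin]|_ [u [Bu umin] <-]].
  case: (dom w Aw) => [[u Bu hu]|[u Bu]]; last first.
    by rewrite ltNge wmin //; apply: hBA.
  exists u => //; split=> // y By /=; rewrite hu; apply: wmin; exact: hBA.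
split; first exact: hBA.
move=> w Aw; case: (dom w Aw) => [[y By <-]|[y By /ltW]]; first exact: umin.
by apply: le_trans; apply: umin.
Qed.

Lemma lbound_image (R : realType) (T U : Type) (A : set T) (B : set U)
    (h : U -> T) (f : T -> R) (l : R) :
  (forall w, A w -> (h @` B) w \/ exists2 u, B u & f (h u) < f w) ->
  lbound ((f \o h) @` B) l -> lbound (f @` A) l.
Proof.
move=> dom lB _ [w Aw <-]; have lBE u : B u -> l <= f (h u).
  by move=> Bu; apply: lB; exists u.
case: (dom w Aw) => [[u Bu <-]|[u Bu /ltW]]; first exact: lBE.
by apply: le_trans; apply: lBE.
Qed.

(** Lets strict inequalities pass through [Num.sqrt], which is constant on nonpositive numbers. *)
Lemma normalized_cost_gt0 (R : realType) (v t a b c : R) :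
  0 < v -> 0 <= t -> 0 < a -> 0 < b -> 0 < c -> 0 < normalized_cost v t a b c.
Proof.
move=> v0 t0 a0 b0 c0; rewrite /normalized_cost mulr_gt0 //.
  by rewrite ltr_wpDr ?mulr_ge0 ?mulr_gt0 ?addr_gt0 // ltW.
by rewrite addr_gt0 ?divr_gt0 // mulr_gt0 ?addr_gt0 ?invr_gt0.
Qed.

(** For t = 0 the singular term t / (2 a) vanishes identically; this case serves the limit at 0. *)
Lemma symmetric_cost_continuous (R : realType) (v t a : R) :
  t = 0 \/ a != 0 -> {for a, continuous (symmetric_cost v t)}.
Proof.
move=> ta; rewrite /prop_for /continuous_at /symmetric_cost.
apply: cvgD; last by do 2!apply: cvgMr_tmp; exact: cvg_id.
apply: cvgD; first exact: cvg_cst.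
case: ta => [->|a0].
  by under eq_cvg do rewrite mul0r; rewrite mul0r; exact: cvg_cst.
apply: cvgMl_tmp; apply: cvgV; first by rewrite mulf_neq0 ?pnatr_eq0.
by apply: cvgMl_tmp; exact: cvg_id.
Qed.

Lemma symmetric_weights_interior (R : realType) (a : R) :
  0 < a < 1 -> interior_weights R 3 (symmetric_weights a).
Proof.
move=> /andP[a0 a1]; split=> [i|].
  by rewrite ffunE; case: ifP => // _; rewrite divr_gt0 // subr_gt0.
by rewrite sum_ord3 /= !ffunE /=; field.
Qed.

Lemma symmetric_weightsE (R : realType) (w : {ffun 'I_3 -> R}) :
  w currency0 + w currency1 + w currency2 = 1 -> w currency1 = w currency2 ->
  w = symmetric_weights (w currency0).
Proof.
move=> w1 w12; apply/ffunP => -[[|[|[|//]]] i]; rewrite ffunE.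
- by rewrite -val_eqE /=; congr (w _); apply: val_inj.
- have -> : Ordinal i = currency1 by apply: val_inj.
  by rewrite /=; lra.
- have -> : Ordinal i = currency2 by apply: val_inj.
  by rewrite /=; lra.
Qed.

Theorem proposition6 (R : realType) (q sigma Delta v s : R)
    (EQ var : 'I_3 -> 'I_3 -> R)
    (q_gt0 : 0 < q) (sigma_gt0 : 0 < sigma) (Delta_gt0 : 0 < Delta)
    (v_gt0 : 0 < v) (s_range : 0 <= s <= 2)
    (EQ_sym : forall i j, EQ i j = EQ j i)
    (EQ01 : EQ currency0 currency1 = q)
    (EQ02 : EQ currency0 currency2 = q)
    (EQ12 : EQ currency1 currency2 = v * q)
    (var01 : var currency0 currency1 = sigma ^+ 2)
    (var02 : var currency0 currency2 = sigma ^+ 2)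
    (var12 : var currency1 currency2 = s ^+ 2 * sigma ^+ 2) :
  let c := trading_cost Delta EQ var in
  let csym := fun w0 : R => c (symmetric_weights w0) in
  let W := interior_weights R 3 in
  let W0 := [set w0 : R | 0 < w0 < 1] in
  let threshold := 2 * (1 + 2 * v) / (1 + v) in
  let w0star := s / Num.sqrt ((1 + 2 * v) * (4 - s ^+ 2)) in
  let cstar := Num.sqrt (q * sigma ^+ 2 * Delta) *
    Num.sqrt (s ^+ 2 * v + 2 + s * Num.sqrt ((4 - s ^+ 2) * (1 + 2 * v))) in
  (s ^+ 2 < threshold ->
     (0 < s ->
        [/\ argmin W c = [set symmetric_weights w0star],
            argmin W0 csym = [set w0star] &
            c (symmetric_weights w0star) = cstar]) /\
     (s = 0 ->
        [/\ w0star = 0, argmin W c = set0, argmin W0 csym = set0,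
            inf (c @` W) = cstar /\ inf (csym @` W0) = cstar &
            csym w0 @[w0 --> (0 : R)^'+] --> cstar])) /\
  (threshold <= s ^+ 2 ->
     [/\ argmin W c = set0, argmin W0 csym = set0,
         csym w0 @[w0 --> (1 : R)^'-] --> inf (c @` W) &
         csym w0 @[w0 --> (1 : R)^'-] --> inf (csym @` W0)]).
Proof.
move=> c csym W W0 threshold w0star cstar.
have /andP[s0 s2] := s_range.
have t0 : 0 <= s ^+ 2 by apply: sqr_ge0.
have t4 : s ^+ 2 <= 4 by nra.
set K := q * sigma ^+ 2 * Delta.
have K0 : 0 < K by rewrite !mulr_gt0 ?exprn_gt0.

(* Reduction to the scalar problem in w_0 *)
have cE w : c w = Num.sqrt (K * normalized_cost v (s ^+ 2) (w currency0)
    (w currency1) (w currency2)) by exact: trading_costE.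
have csymE a : W0 a -> csym a = Num.sqrt (K * symmetric_cost v (s ^+ 2) a).
  move=> a01; rewrite /csym cE !ffunE /=; congr (Num.sqrt (K * _)).
  exact: normalized_cost_symmetric.
have SC_gt0 a : W0 a -> 0 < symmetric_cost v (s ^+ 2) a.
  move=> /andP[a0 a1]; rewrite -normalized_cost_symmetric ?a0 //.
  by apply: normalized_cost_gt0; rewrite ?divr_gt0 ?subr_gt0.
have csym_lt a b : W0 a -> W0 b -> (csym a < csym b) =
    (symmetric_cost v (s ^+ 2) a < symmetric_cost v (s ^+ 2) b).
  by move=> ? ?; rewrite !csymE // ltr_sqrt ?mulr_gt0 ?SC_gt0 // ltr_pM2l.
have symW a : W0 a -> W (symmetric_weights a) by exact: symmetric_weights_interior.
have dom w : W w -> (@symmetric_weights R @` W0) w \/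
    exists2 a, W0 a & c (symmetric_weights a) < c w.
  move=> [w_gt0]; rewrite sum_ord3 /= => w1.
  have [w12|w12] := eqVneq (w currency1) (w currency2).
    left; exists (w currency0); last exact/esym/symmetric_weightsE.
    by rewrite /W0 /= w_gt0 /=; have := w_gt0 currency1; have := w_gt0 currency2; lra.
  right; have [x x01 lt] := normalized_cost_ge_symmetric v_gt0 s0
    (w_gt0 currency0) (w_gt0 currency1) (w_gt0 currency2) w1 w12.
  exists x => //; rewrite -/(csym x) csymE // cE ltr_sqrt ?ltr_pM2l //.
  by rewrite mulr_gt0 // (lt_trans _ lt) // SC_gt0.
have argminW : argmin W c = @symmetric_weights R @` argmin W0 csym.
  exact: argmin_image symW dom.
(* Handles infima that are not attained: [F] will be the one-sided neighbourhoods of 0 or of 1. *)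
have inf_cvg (F : set_system R) (FF : ProperFilter F) l :
    (\forall x \near F, W0 x) -> lbound (csym @` W0) l -> csym x @[x --> F] --> l ->
    inf (c @` W) = l /\ inf (csym @` W0) = l.
  move=> F01 lW0 cvgl; split; apply: (cvg_inf _ _ cvgl) => //.
  - exact: lbound_image dom lW0.
  - by apply: filterS F01 => x /symW; exists (symmetric_weights x).
  - by apply: filterS F01 => x; exists x.
(* The limit is read off the closed formula, since [a] may be an endpoint of (0, 1), where [csym]
   itself divides by zero. *)
have csym_cvg (F : set_system R) (FF : Filter F) a :
    s ^+ 2 = 0 \/ a != 0 -> F --> a -> (\forall x \near F, W0 x) ->
    csym x @[x --> F] --> Num.sqrt (K * symmetric_cost v (s ^+ 2) a).
  move=> sa Fa F01.
  apply: (@cvg_trans _ (Num.sqrt (K * symmetric_cost v (s ^+ 2) x) @[x --> F])).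
    by apply: near_eq_cvg; apply: filterS F01 => x /csymE.
  apply: continuous_cvg; first exact: sqrt_continuous.
  apply: cvgMl_tmp; apply: continuous_cvg Fa.
  exact: symmetric_cost_continuous.
have near0 : \forall x \near (0 : R)^'+, W0 x.
  near=> x; apply/andP; split; near: x; first exact: nbhs_right_gt.
  exact: nbhs_right_lt.
have near1 : \forall x \near (1 : R)^'-, W0 x.
  near=> x; apply/andP; split; near: x; first exact: nbhs_left_gt.
  exact: nbhs_left_lt.
have A_ge0 : 0 <= (4 - s ^+ 2) * (1 + 2 * v) by rewrite mulr_ge0 ?subr_ge0 //; lra.
set r := Num.sqrt ((4 - s ^+ 2) * (1 + 2 * v)) in cstar *.
have r2 : r ^+ 2 = (4 - s ^+ 2) * (1 + 2 * v) by rewrite sqr_sqrtr.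
have r0 : 0 <= r by exact: sqrtr_ge0.
have cstarE : cstar = Num.sqrt (K * (s ^+ 2 * v + 2 + s * r)).
  by rewrite (@sqrtrM _ K) // ltW.
have w0starE : w0star = s / r by rewrite /w0star (mulrC (1 + 2 * v)).
have SCE a : 0 < a -> symmetric_cost v (s ^+ 2) a =
    s ^+ 2 * v + 2 + s * r + (s - a * r) ^+ 2 / (2 * a).
  by move=> a0; apply: symmetric_cost_completed_square.
have lb_cstar : lbound (csym @` W0) cstar.
  move=> _ [a a01 <-]; rewrite csymE // cstarE ler_wsqrtr // ler_pM2l //.
  have /andP[a0 _] := a01.
  by rewrite SCE // lerDl divr_ge0 ?sqr_ge0 // mulr_ge0 // ltW.
split=> [lt_thr|ge_thr].

  (* Below the threshold *)
  split=> [sgt0|s_eq0].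
    (* The threshold condition rearranges to s^2 < (4 - s^2) (1 + 2 v), which places s / r below
       1. *)
    have s_lt_r : s < r.
      rewrite -ltr_sqr ?nnegrE // r2; move: lt_thr; rewrite ltr_pdivlMr; lra.
    have r_gt0 : 0 < r by exact: lt_trans s_lt_r.
    have w01 : W0 w0star.
      by rewrite w0starE /W0 /= divr_gt0 //= ltr_pdivrMr // mul1r.
    have SCstar : symmetric_cost v (s ^+ 2) w0star = s ^+ 2 * v + 2 + s * r.
      rewrite SCE; last by case/andP: w01.
      by rewrite w0starE divfK ?gt_eqF // subrr expr0n mul0r addr0.
    have csym_star : csym w0star = cstar by rewrite csymE // SCstar cstarE.
    have argminW0 : argmin W0 csym = [set w0star].
      apply/seteqP; split=> [a [a01 amin]|_ ->]; last first.
        by split=> // a a01; rewrite csym_star; apply: lb_cstar; exists a.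
      have := amin _ w01; rewrite leNgt csym_lt // -leNgt SCstar.
      have /andP[a0 _] := a01.
      rewrite SCE // gerDl pmulr_lle0 ?invr_gt0 ?mulr_gt0 // => sq_le0.
      have : (s - a * r) ^+ 2 == 0 by rewrite eq_le sq_le0 sqr_ge0.
      rewrite sqrf_eq0 subr_eq0 => /eqP sE.
      by rewrite /= w0starE [in RHS]sE mulfK // gt_eqF.
    by split=> //; rewrite argminW argminW0 image_set1.
  have argminW0 : argmin W0 csym = set0.
    apply/seteqP; split=> // a [a01 amin].
    have /andP[a0 a1] := a01.
    (* With s = 0 the symmetric cost is 2 + 2 (1 + 2 v) a, so halving [a] lowers it. *)
    have h01 : W0 (a / 2) by apply/andP; split; lra.
    have := amin _ h01; rewrite leNgt csym_lt // /symmetric_cost s_eq0.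
    by rewrite expr0n /= !mul0r !addr0 subr0; nra.
  have cvg0 : csym w0 @[w0 --> (0 : R)^'+] --> cstar.
    have := csym_cvg _ _ 0 _ (cvg_at_right_filter cvg_id) near0.
    rewrite cstarE /symmetric_cost s_eq0 expr0n /= !(mul0r, addr0, add0r).
    by apply; left.
  split=> //; first by rewrite w0starE s_eq0 mul0r.
    by rewrite argminW argminW0 image_set0.
  exact: inf_cvg near0 lb_cstar cvg0.

(* At or above the threshold *)
have dec := symmetric_cost_decreasing v_gt0 t4 ge_thr.
have argminW0 : argmin W0 csym = set0.
  apply/seteqP; split=> // a [a01 amin].
  have /andP[a0 a1] := a01.
  (* Moving halfway towards 1 lowers the cost. *)
  have h01 : W0 ((a + 1) / 2) by apply/andP; split; lra.
  have := amin _ h01; rewrite leNgt csym_lt // dec // ?in_itv /=; lra.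
have cvg1 : csym x @[x --> (1 : R)^'-] -->
    Num.sqrt (K * symmetric_cost v (s ^+ 2) 1).
  apply: csym_cvg near1; first by right; rewrite oner_neq0.
  exact: cvg_at_left_filter cvg_id.
(* Monotonicity up to the endpoint makes the limit at 1 a lower bound, hence the value of both
   infima. *)
have [|-> ->] := inf_cvg _ _ _ near1 _ cvg1.
  move=> _ [a a01 <-]; have /andP[a0 a1] := a01.
  rewrite csymE // ler_wsqrtr // ler_pM2l // ltW // dec // in_itv /= ?a0 ?ltr01 ?lexx //.
  exact: ltW.
by split=> //; rewrite argminW argminW0 image_set0.
Unshelve. all: by end_near. Qed.
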